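(* Let $n\ge1$, $-\frac1n<\alpha<0$, $\kappa=\frac{\alpha}{1+n\alpha}$, and $f\in C_\alpha(\mathbb{R}^n)$. Then $$w_\alpha(f)\ge\int G_\alpha\cdot\Big[\frac n2+\frac1\kappa\Big(\frac{\int f}{\int G_\alpha}\Big)^{\kappa}-\frac1\kappa\Big].$$
   Context: For $-\infty<\alpha<0$, a function $f:\mathbb{R}^n\to[0,\infty)$ is $\alpha$-concave if it is supported on a convex set $\Omega$ and $f(\lambda x+(1-\lambda)y)\ge[\lambda f(x)^\alpha+(1-\lambda)f(y)^\alpha]^{1/\alpha}$ for all $x,y\in\Omega$, $\lambda\in[0,1]$. $C_\alpha(\mathbb{R}^n)$ is the set of upper semicontinuous $\alpha$-concave $f\not\equiv0$. With $\beta=-1/\alpha$, $\mathrm{base}_\alpha(f)=\frac{1-f^\alpha}{\alpha}$ (with $0^\alpha=+\infty$); equivalently $f=(1+\mathrm{base}_\alpha f/\beta)^{-\beta}$. The $\alpha$-sum is defined by $\mathrm{base}_\alpha(f\star_\alpha g)=(\mathrm{base}_\alpha f)\square(\mathrm{base}_\alpha g)$ with $(\phi\square\psi)(x)=\inf_{y+z=x}[\phi(y)+\psi(z)]$, and $\mathrm{base}_\alpha(\lambda\cdot_\alpha f)(x)=\lambda(\mathrm{base}_\alpha f)(x/\lambda)$ for $\lambda>0$. $G_\alpha(x)=(1+\frac{|x|^2}{2\beta})^{-\beta}$, and $w_\alpha(f)=\lim_{\epsilon\to0^+}\frac{\int G_\alpha\star_\alpha[\epsilon\cdot_\alpha f]-\int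 G_\alpha}{\epsilon}$. If $\int f=+\infty$, $(\int f/\int G_\alpha)^\kappa$ is interpreted as $0$. *)

(* Defs.v *)
From HB Require Import structures.
From mathcomp Require Import all_boot all_order all_algebra.
From mathcomp Require Import all_classical all_reals all_analysis.
Set Implicit Arguments. Unset Strict Implicit. Unset Printing Implicit Defensive.
Import Order.TTheory GRing.Theory Num.Theory.
Import numFieldNormedType.Exports.
Local Open Scope classical_set_scope.
Local Open Scope ring_scope.

Section AlphaConcave.
Variable R : realType.

Definition sqnorm (n : nat) (x : 'rV[R]_n) : R := \sum_(i < n) x ord0 i ^+ 2.

(* Lebesgue integral over R^n of a nonnegative \bar R-valued function,
   realised as the iterated one-dimensional Lebesgue integral
   (x_0 outermost).  For the nonnegative Borel functions occurring here
   this equals the integral w.r.t. n-dimensional Lebesgue measure (Tonelli). *)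
Fixpoint intRn (n : nat) : ('rV[R]_n -> \bar R) -> \bar R :=
  match n return ('rV[R]_n -> \bar R) -> \bar R with
  | 0 => fun h => h 0
  | m.+1 => fun h =>
      (\int[@lebesgue_measure R]_(t in [set: R])
          intRn (fun v : 'rV[R]_m => h (row_mx (const_mx t : 'rV[R]_1) v)))%E
  end.

Definition usc (n : nat) (f : 'rV[R]_n -> R) : Prop :=
  forall x t, f x < t -> exists2 d : R, 0 < d &
    forall y, sqnorm (y - x) < d ^+ 2 -> f y < t.

Definition alpha_concave (n : nat) (a : R) (f : 'rV[R]_n -> R) : Prop :=
  (forall x, 0 <= f x) /\
  (forall x y l, 0 < f x -> 0 < f y -> 0 <= l <= 1 ->
     0 < f (l *: x + (1 - l) *: y)) /\
  (forall x y l, 0 < f x -> 0 < f y -> 0 <= l <= 1 ->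
     (l * f x `^ a + (1 - l) * f y `^ a) `^ a^-1 <= f (l *: x + (1 - l) *: y)).

Definition C_alpha (n : nat) (a : R) (f : 'rV[R]_n -> R) : Prop :=
  alpha_concave a f /\ usc f /\ exists x, f x != 0.

Definition beta_of (a : R) : R := - a^-1.

(* base_alpha f = (1 - f^a)/a, with 0^a = +oo *)
Definition base_alpha (n : nat) (a : R) (f : 'rV[R]_n -> R) (x : 'rV[R]_n) : \bar R :=
  if 0 < f x then ((1 - f x `^ a) / a)%:E else +oo%E.

(* inverse of base: f = (1 + phi/beta)^(-beta), with +oo |-> 0.
   (Values phi <= -beta, which never occur for the small-epsilon sums used
   below, are sent to +oo.) *)
Definition unbase (a : R) (phi : \bar R) : \bar R :=
  match phi with
  | r%:E => if 0 < 1 + r / beta_of a then ((1 + r / beta_of a) `^ (- beta_of a))%:E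
            else +oo%E
  | +oo%E => 0%E
  | -oo%E => +oo%E
  end.

Definition infconv (n : nat) (phi psi : 'rV[R]_n -> \bar R) (x : 'rV[R]_n) : \bar R :=
  ereal_inf [set (phi y + psi (x - y)%R)%E | y in [set: 'rV[R]_n]].

Definition alpha_sum_base (n : nat) (a : R) (phi psi : 'rV[R]_n -> \bar R) :=
  infconv phi psi.

Definition alpha_scale_base (n : nat) (a : R) (l : R) (f : 'rV[R]_n -> R) (x : 'rV[R]_n) : \bar R :=
  (l%:E * base_alpha a f (l^-1 *: x))%E.

Definition G_alpha (n : nat) (a : R) (x : 'rV[R]_n) : R :=
  (1 + sqnorm x / (2 * beta_of a)) `^ (- beta_of a).

Definition G_sum_eps (n : nat) (a eps : R) (f : 'rV[R]_n -> R) (x : 'rV[R]_n) : \bar R :=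
  unbase a (alpha_sum_base a (base_alpha a (@G_alpha n a)) (alpha_scale_base a eps f) x).

Definition w_quot (n : nat) (a : R) (f : 'rV[R]_n -> R) (eps : R) : \bar R :=
  ((intRn (G_sum_eps a eps f) - intRn (fun x : 'rV[R]_n => (G_alpha a x)%:E)) * (eps^-1)%:E)%E.

(* w_alpha(f) = lim_{eps -> 0+} w_quot; we use the lower limit (liminf),
   which coincides with the limit whenever the latter exists. *)
Definition w_alpha_liminf (n : nat) (a : R) (f : 'rV[R]_n -> R) : \bar R :=
  limf_einf (w_quot a f) (0 : R)^'+.

(* (I / g)^k for I in [0,+oo], g > 0 real, k < 0;
   +oo |-> 0 (convention of the paper), 0 |-> +oo (0^k = +oo for k < 0). *)
Definition ratio_pow (I : \bar R) (g k : R) : \bar R :=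
  match I with
  | r%:E => if r == 0 then +oo%E else ((r / g) `^ k)%:E
  | +oo%E => 0%E
  | -oo%E => +oo%E
  end.

End AlphaConcave.

(* Main.v *)
(** Write b = -1/a and e for epsilon. In terms of a-th powers the a-sum h of
   [G_alpha] and e.f satisfies
     h(sqrt(1-e) x + e y)^a <= (1-e) G_alpha(x)^a + e f(y)^a,
   so the Borell-Brascamp-Lieb inequality bounds its integral below by
   g ((1-e)^(1-nk/2) + e (I/g)^k)^(1/k), where g and I are the integrals of
   [G_alpha] and f. The claimed bound is the derivative of this quantity at
   e = 0; elementary inequalities for exp and ln replace the differentiation.

   Borell-Brascamp-Lieb goes by induction on the dimension. On the line, let
   u, v have suprema U, V and let h(x + y) >= M_b(u(x), v(y)) for the power
   mean M_b. The superlevel sets {u > rU} and {v > rV} have their sumset inside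
   {h >= r M_b(U, V)}, and |A + B| >= |A| + |B|; summing over a grid of values
   of r gives int h >= M_b(U, V) (int u / U + int v / V), and Hoelder's
   inequality for means eliminates U and V. The integral of a nonnegative
   function is the supremum over simple functions below it, so this needs no
   measurability, neither of h nor of the partial integrals. *)
Require Import Defs.
From HB Require Import structures.
From mathcomp Require Import all_boot all_order all_algebra.
From mathcomp Require Import all_classical all_reals all_analysis.
From mathcomp Require Import measurable_realfun.
From mathcomp Require Import ring lra.
Import Order.TTheory GRing.Theory Num.Theory.
Import numFieldNormedType.Exports.
Local Open Scope classical_set_scope.
Local Open Scope ring_scope.
Set Implicit Arguments.
Unset Strict Implicit.

(** * Integration on the line by simple functions, and affine images *)

Section Integral.
Context {R : realType}.
Local Notation mu := (@lebesgue_measure R).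
Import HBNNSimple.

Lemma integral_gt_nnsfun (f : R -> \bar R) (s : \bar R) :
  (forall x, 0 <= f x)%E -> (s < \int[mu]_x f x)%E ->
  exists2 p : {nnsfun measurableTypeR R >-> R},
    (forall x, (p x)%:E <= f x)%E & (s < \int[mu]_x (p x)%:E)%E.
Proof.
move=> f0; rewrite ge0_integralTE// => /ereal_sup_gt[_ [p /= pf <-]] sp.
by exists p => //; rewrite integral_nnsfun// patch_setT.
Qed.

Lemma le_integralT (f g : R -> \bar R) : (forall x, 0 <= f x)%E ->
  (forall x, f x <= g x)%E -> (\int[mu]_x f x <= \int[mu]_x g x)%E.
Proof.
move=> f0 fg; have g0 x : (0 <= g x)%E by apply: le_trans (fg x).
rewrite !ge0_integralTE//; apply: ereal_sup_le => _ [p /= pf <-].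
by exists p => // x; apply: le_trans (fg x).
Qed.

(** The pushforward of [mu] under the inverse map [p], divided by [c], agrees with [mu] on half-open
    intervals, so uniqueness of Lebesgue measure identifies the two. *)
Lemma lebesgue_measure_affine (c b : R) (A : set R) : 0 < c -> measurable A ->
  measurable [set c * x + b | x in A] /\
  mu [set c * x + b | x in A] = (c%:E * mu A)%E.
Proof.
move=> c0 mA; have c0' : c != 0 by rewrite gt_eqF.
pose p (x : measurableTypeR R) : measurableTypeR R := (x - b) / c.
have cp : continuous (p : R -> R).
  by move=> x; apply: cvgM; [apply: cvgB; [exact: cvg_id|exact: cvg_cst]|exact: cvg_cst].
have mp : measurable_fun [set: measurableTypeR R] p.
  exact: (continuous_measurable_fun cp).
have imE (B : set R) : [set c * x + b | x in B] = p @^-1` B.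
  apply/seteqP; split => [_ [x Bx <-]|x Bx] /=.
    by rewrite /p addrK mulrC mulKf.
  by exists (p x) => //; rewrite /p mulrC divfK// subrK.
split; first by rewrite imE -[X in measurable X]setTI; exact: mp.
have ci0 : 0 <= c^-1 by rewrite invr_ge0 ltW.
pose nu : {measure set (measurableTypeR R) -> \bar R} :=
  mscale (NngNum ci0) (measure_function_pushforward__canonical__measure_function_Measure mu mp).
have nuE : mu A = nu A.
  apply: (@lebesgue_measure_unique _ nu) => // _ [[u v]] /= _ <-.
  rewrite /nu /mscale/= /pushforward.
  have -> : p @^-1` `]u, v] = `]c * u + b, c * v + b]%classic.
    rewrite -imE; apply/seteqP; split => [_ [x /= + <-]|x] /=; rewrite !in_itv/=.
      by rewrite ltrD2r lerD2r ltr_pM2l// ler_pM2l.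
    move=> /andP[ux xv]; exists (p x); last by rewrite /p mulrC divfK// subrK.
    by rewrite in_itv/= /p ltr_pdivlMr// ler_pdivrMr// ltrBrDr lerBlDr mulrC ux mulrC.
  rewrite !lebesgue_measure_itv/= !lte_fin ltrD2r ltr_pM2l//.
  case: ifPn => _; last by rewrite mule0.
  by rewrite -!EFinD -EFinM; congr EFin; field.
rewrite nuE /nu /mscale/= muleA -EFinM mulfV// mul1e /pushforward.
by rewrite imE.
Qed.

End Integral.

(** * The one-dimensional Brunn-Minkowski inequality *)

Section Sumset.
Context {R : realType}.
Local Notation mu := (@lebesgue_measure R).

(** With [k] the maximum of [K] and [l] the minimum of [L], the sets [c K + d l] and [c k + d L] lie
    on either side of [p = c k + d l] and meet only there. *)
Lemma compact_sumset_measure (c d : R) (K L : set R) : 0 < c -> 0 < d ->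
  compact K -> compact L -> K !=set0 -> L !=set0 ->
  exists C : set R, [/\ measurable C, C `<=` [set c * x + d * y | x in K & y in L]
    & (c%:E * mu K + d%:E * mu L <= mu C)%E].
Proof.
move=> c0 d0 cK cL K0 L0.
have ci (A : set R) : {within A, continuous (id : R -> R)}.
  by apply: continuous_subspaceT => x; exact: cvg_id.
have [k /set_mem Kk kmax] := compact_EVT_max K0 cK (ci K).
have [l /set_mem Ll lmin] := compact_EVT_min L0 cL (ci L).
have mK := compact_measurable cK; have mL := compact_measurable cL.
have [m1 e1] := lebesgue_measure_affine (d * l) c0 mK.
have [m2 e2] := lebesgue_measure_affine (c * k) d0 mL.
set C1 := [set _ | _ in K] in m1 e1; set C2 := [set _ | _ in L] in m2 e2.
pose p := c * k + d * l; have mp : measurable [set p] by exact: measurable_set1.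
have mD : measurable (C2 `\ p) by exact: measurableD.
exists (C1 `|` (C2 `\ p)); split.
- exact: measurableU.
- move=> _ [[x Kx <-]|[[y Ly <-] _]]; first by exists x => //; exists l.
  by exists k => //; exists y => //; rewrite addrC.
rewrite measureU//; last first.
  rewrite -subset0 => _ /= [[x Kx <-] [[y Ly xy] ne]]; apply: ne.
  have xk : x <= k by apply: kmax; rewrite inE.
  have ly : l <= y by apply: lmin; rewrite inE.
  have cxk : c * x <= c * k by rewrite ler_pM2l.
  have dly : d * l <= d * y by rewrite ler_pM2l.
  apply/eqP; rewrite eq_le; apply/andP; split; first by rewrite lerD2r.
  by rewrite -xy /p addrC lerD2r.
rewrite -e1 -e2 leeD2l//.
apply: (@le_trans _ _ (mu ((C2 `\ p) `|` [set p]))).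
  apply: le_measure; rewrite ?inE//; first exact: measurableU.
  by move=> x C2x; have [->|/eqP xp] := eqVneq x p; [right|left].
apply: (@le_trans _ _ (mu (C2 `\ p) + mu [set p])%E).
  exact: measureU2.
by rewrite [X in (_ + X)%E](_ : _ = 0%E) ?adde0//; exact: lebesgue_measure_set1.
Qed.

Lemma lebesgue_measure_le_compact (A : set R) (u : \bar R) : measurable A -> A !=set0 ->
  (forall K, compact K -> K !=set0 -> K `<=` A -> mu K <= u)%E -> (mu A <= u)%E.
Proof.
move=> mA [a Aa] Ku; rewrite lebesgue_regularity_inner_sup//.
apply: ge_ereal_sup => _ [K [cK KA] <-].
have [->|/set0P K0] := eqVneq K set0; last exact: Ku.
(* The bound is assumed for nonempty compacts only; a point of [A] replaces the empty set, both
   having measure 0. *)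
rewrite measure0 -(@lebesgue_measure_set1 R a); apply: Ku.
- exact: compact_set1.
- by exists a.
- by move=> _ ->.
Qed.

(** A sumset of measurable sets need not be measurable, whence the measurable [C] inside it. Inner
    regularity extends the bound from compact sets to the supremum [u] of the measures of such sets,
    and a countable union of near-optimal ones attains [u]. *)
Lemma sumset_measure (c d : R) (A B : set R) : 0 < c -> 0 < d ->
  measurable A -> measurable B -> A !=set0 -> B !=set0 ->
  exists C : set R, [/\ measurable C, C `<=` [set c * x + d * y | x in A & y in B]
    & (c%:E * mu A + d%:E * mu B <= mu C)%E].
Proof.
move=> c0 d0 mA mB A0 B0; set S := [set _ | _ in A & _ in B].
pose u := ereal_sup [set mu C | C in [set C | measurable C /\ C `<=` S]].
have uge : (c%:E * mu A + d%:E * mu B <= u)%E.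
  have H K L : compact K -> compact L -> K !=set0 -> L !=set0 ->
      K `<=` A -> L `<=` B -> (c%:E * mu K + d%:E * mu L <= u)%E.
    move=> cK cL K0 L0 KA LB.
    have [C [mC CKL]] := compact_sumset_measure c0 d0 cK cL K0 L0.
    move/le_trans; apply; apply: ereal_sup_ubound; exists C => //; split => //.
    by apply: (subset_trans CKL) => _ [x Kx [y Ly <-]]; exists x; [exact: KA|exists y; [exact: LB|]].
  have [->|uy] := eqVneq u +oo%E; first exact: leey.
  have u0 : (0 <= u)%E.
    apply: ereal_sup_ubound; exists set0; last by rewrite measure0.
    by split; [exact: measurable0|exact: sub0set].
  have uf : u \is a fin_num by rewrite ge0_fin_numE// ltey.
  (* [A] and [B] are exhausted one after the other: each passage to the supremum subtracts the other
     term, which has to be finite. *)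
  have cA L : compact L -> L !=set0 -> L `<=` B -> (c%:E * mu A + d%:E * mu L <= u)%E.
    move=> cL L0 LB; have fL : (d%:E * mu L)%E \is a fin_num.
      by rewrite fin_numM// ge0_fin_numE// compact_finite_measure.
    rewrite -leeBrDr// -lee_pdivlMl//; apply: lebesgue_measure_le_compact => // K cK K0 KA.
    by rewrite lee_pdivlMl// leeBrDr//; exact: H.
  (* A singleton in [B] has measure 0, so [cA] bounds [c * mu A] by the finite [u]. *)
  have fA : (c%:E * mu A)%E \is a fin_num.
    have [b Bb] := B0.
    rewrite ge0_fin_numE ?mule_ge0 ?lee_fin ?(ltW c0)// (@le_lt_trans _ _ u)// ?ltey//.
    have := @cA [set b] (@compact_set1 _ b) (ex_intro _ b erefl).
    by rewrite lebesgue_measure_set1 mule0 adde0; apply=> _ ->.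
  rewrite -leeBrDl// -lee_pdivlMl//; apply: lebesgue_measure_le_compact => // L cL L0 LB.
  by rewrite lee_pdivlMl// leeBrDl//; exact: cA.
have /choice[C HC] (q : rat) : exists C : set R, [/\ measurable C, C `<=` S
    & ((ratr q)%:E < u -> (ratr q)%:E < mu C)%E].
  have [/ereal_sup_gt[_ [C [mC CS] <-] qC]|/negP nqu] := boolP ((ratr q)%:E < u)%E.
    by exists C.
  by exists set0; split.
exists (\bigcup_q C q); have mUC : measurable (\bigcup_q C q).
  by apply: bigcupT_measurable_rat => q; have [] := HC q.
split=> //; first by move=> x [q _]; have [_ + _] := HC q; exact.
apply: (le_trans uge); rewrite leNgt; apply/negP => vu.
(* As [u] may be infinite, two reals [r' < r] are inserted below it, and a rational [q] between
   them. *)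
have [r /andP[vr ru]] : exists r : R, ((mu (\bigcup_q C q) < r%:E) && (r%:E < u))%E.
  move: vu; have : (0 <= mu (\bigcup_q C q))%E by [].
  case: (mu _) => [v| |] // _; case: u {uge HC} => [w| |] //.
  - by rewrite lte_fin => vw; exists ((v + w) / 2); rewrite !lte_fin !(midf_lt vw).
  - by move=> _; exists (v + 1); rewrite lte_fin ltry ltrDl ltr01.
have [r' /andP[vr' rr']] : exists r' : R, ((mu (\bigcup_q C q) < r'%:E) && (r'%:E < r%:E))%E.
  move: vr; have : (0 <= mu (\bigcup_q C q))%E by [].
  case: (mu _) => [v| |] // _; rewrite lte_fin => vw.
  by exists ((v + r) / 2); rewrite !lte_fin !(midf_lt vw).
rewrite lte_fin in rr'; have [q] := rat_in_itvoo rr'; rewrite in_itv/= => /andP[rq qr].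
have [mC _ /(_ _)/ltW Cq] := HC q.
have : (mu (C q) <= mu (\bigcup_q C q))%E.
  by apply: le_measure; rewrite ?inE//; exact: bigcup_sup.
apply/negP; rewrite -ltNge (lt_le_trans vr')//; apply: le_trans (Cq _).
  by rewrite lee_fin ltW.
by rewrite (lt_trans _ ru)// lte_fin.
Qed.

End Sumset.

(** * Power means and tangent inequalities for powers *)

Section PowerMean.
Context {R : realType}.
Implicit Types b c r s t x F G : R.

(** The power mean of exponent [-1/b] without weights: a weight [w] on a summand is expressed by
    multiplying its argument by [w ^ (-b)]. *)
Definition pmean b s t : R := (s `^ (- b^-1) + t `^ (- b^-1)) `^ (- b).

Lemma pmean_gt0 b s t : 0 < s -> 0 < t -> 0 < pmean b s t.
Proof. by move=> s0 t0; rewrite powR_gt0// addr_gt0// powR_gt0. Qed.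

Lemma pmeanZ b r s t : 0 < b -> 0 < r -> 0 < s -> 0 < t ->
  pmean b (r * s) (r * t) = r * pmean b s t.
Proof.
move=> b0 r0 s0 t0; rewrite /pmean !powRM ?ltW// -mulrDr powRM ?powR_ge0//.
  by rewrite -powRrM mulrNN mulVf ?gt_eqF// powRr1// ltW.
by rewrite addr_ge0// powR_ge0.
Qed.

(** This is Young's inequality for the product of [s] and 1, with conjugate exponents [b] and
    [b / (b - 1)]. *)
Lemma powR_ge_tangent b s : 1 < b -> 0 <= s -> 1 + b * (s - 1) <= s `^ b.
Proof.
move=> b1 s0; have b0 : 0 < b by rewrite (lt_trans _ b1).
have q0 : 0 < b / (b - 1) by rewrite divr_gt0// subr_gt0.
have := @conjugate_powR R s 1 b (b / (b - 1)) s0 ler01 b0 q0.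
have e : b^-1 + (b / (b - 1))^-1 = 1.
  by field; rewrite !gt_eqF// subr_gt0.
move=> /(_ e); rewrite mulr1 powR1 div1r => H.
have -> : 1 + b * (s - 1) = b * (s - (b / (b - 1))^-1).
  by field; rewrite !gt_eqF// subr_gt0.
rewrite mulrC -ler_pdivlMr//; lra.
Qed.

(* Jensen's inequality for the convex power [b], with weights the reciprocal
   powers of [s] and [t]. *)
Lemma pmean_holder b F G s t : 1 < b -> 0 < F -> 0 < G -> 0 < s -> 0 < t ->
  pmean (b - 1) s t <= pmean b F G * (s / F + t / G).
Proof.
move=> b1 F0 G0 s0 t0; have b0 : 0 < b by rewrite (lt_trans _ b1).
have e0 : 0 < b - 1 by rewrite subr_gt0.
have inv (x c : R) : 0 < c -> 0 < x -> (x `^ (- c^-1)) `^ c = x^-1.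
  by move=> c0 x0; rewrite -powRrM mulNr mulVf ?gt_eqF// powR_inv1// ltW.
have invN (x c : R) : 0 < c -> 0 < x -> (x `^ (- c^-1)) `^ (- c) = x.
  by move=> c0 x0; rewrite powRN inv// invrK.
rewrite /pmean; set P := s `^ _; set Q := t `^ _; set X := F `^ _; set Y := G `^ _.
have [P0 Q0 X0 Y0] : [/\ 0 < P, 0 < Q, 0 < X & 0 < Y] by split; exact: powR_gt0.
have PE : s = P `^ (1 - b) by rewrite -opprB invN.
have QE : t = Q `^ (1 - b) by rewrite -opprB invN.
rewrite -(inv F b)// -(inv G b)// -/X -/Y PE QE.
clearbody P Q X Y.
have PQ0 : 0 < P + Q by rewrite addr_gt0.
have XY0 : 0 < X + Y by rewrite addr_gt0.
(* The tangent at 1 is used at [W (P + Q) / ((X + Y) U)] and multiplied by [U]. On adding the cases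
   [(X, P)] and [(Y, Q)] the terms with factor [b] cancel. *)
have tang (W U : R) : 0 < W -> 0 < U ->
    U + b * (W / (X + Y) * (P + Q) - U) <=
    (P + Q) `^ b * ((X + Y) `^ (- b) * (U `^ (1 - b) * W `^ b)).
  move=> W0 U0; have z0 : 0 <= W * ((X + Y)^-1 * ((P + Q) * U^-1)).
    by rewrite !mulr_ge0 ?invr_ge0 ?ltW.
  have := powR_ge_tangent b1 z0.
  rewrite !powRM ?mulr_ge0 ?invr_ge0 ?(ltW PQ0) ?(ltW XY0) ?(ltW W0) ?(ltW U0)//.
  rewrite -(ler_pM2l U0) => H; apply: (le_trans (le_trans _ H)).
    rewrite le_eqVlt; apply/orP; left; apply/eqP; field.
    by rewrite !gt_eqF.
  rewrite powRD; last by rewrite (gt_eqF U0) implybT.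
  rewrite powRr1 ?(ltW U0)// -(powR_inv1 (ltW U0)) -(powR_inv1 (ltW XY0)) -!powRrM !mulN1r.
  move: (W `^ b) ((X + Y) `^ (- b)) ((P + Q) `^ b) (U `^ (- b)) => w x y z.
  rewrite le_eqVlt; apply/orP; left; apply/eqP. ring.
have := lerD (tang _ _ X0 P0) (tang _ _ Y0 Q0).
have -> : P + b * (X / (X + Y) * (P + Q) - P) + (Q + b * (Y / (X + Y) * (P + Q) - Q))
  = P + Q by field; rewrite gt_eqF.
rewrite -!mulrDr => H.
rewrite opprB powRD; last by rewrite (gt_eqF PQ0) implybT.
by rewrite powRr1 ?(ltW PQ0)// (powRN (P + Q)) ler_pdivrMr ?powR_gt0// mulrC.
Qed.

Lemma powR_negr_tangent c x : c < 0 -> 0 < x -> 1 + c * (x - 1) <= x `^ c.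
Proof.
move=> c0 x0; rewrite /powR gt_eqF//.
apply: le_trans (expR_ge1Dx _); rewrite lerD2l ler_nM2l//.
have := @le_ln1Dx R (x - 1); rewrite subrKC; apply.
by rewrite ltrBDl subrr.
Qed.

End PowerMean.

(** * Lower sums of superlevel measures *)

Section LayerCake.
Context {R : realType}.
Local Notation mu := (@lebesgue_measure R).

Lemma count_nat_lt (y : R) (N : nat) : y <= N%:R ->
  y - 1 <= \sum_(1 <= i < N) (i%:R < y)%R%:R.
Proof.
elim: N => [|[|N] IH] yN; first by rewrite big_geq//; lra.
  by rewrite big_geq//; lra.
rewrite big_nat_recr//=; have [Ny|yN'] := ltP N.+1%:R y; last first.
  by rewrite (le_trans (IH yN'))// lerDl.
rewrite (_ : \sum_(1 <= i < N.+1) (i%:R < y)%R%:R = N%:R).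
  by rewrite mulr1n natr1 lerBlDr natr1.
rewrite (eq_big_nat _ _ (F2 := fun=> 1)); first by rewrite sumr_const_nat subn1.
by move=> i /andP[_ iN]; rewrite (lt_trans _ Ny)// ltr_nat.
Qed.

(** Applied to the range of a simple function, this lets an additive grid error be absorbed as a
    relative one wherever the function is positive. *)
Lemma finite_set_gap (A : set R) : finite_set A ->
  exists2 m, 0 < m & forall x, A x -> 0 < x -> m <= x.
Proof.
move=> /finite_seqP[r ->]; elim: r => [|y r [m m0 H]]; first by exists 1.
have [y0|y0] := ltP 0 y; last first.
  exists m => // x /=; rewrite inE => /predU1P[->|xr] x0; last exact: H.
  by move: x0; rewrite ltNge y0.
exists (Num.min m y); first by rewrite lt_min m0.
move=> x /=; rewrite inE => /predU1P[->|xr] x0; first by rewrite ge_min lexx orbT.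
by rewrite ge_min H.
Qed.

Lemma finite_set_has_ubound (A : set R) : finite_set A -> has_ubound A.
Proof.
move=> /finite_seqP[r ->]; elim: r => [|y r [M H]]; first by exists 0.
exists (Num.max y M) => x /=; rewrite inE => /predU1P[->|xr]; first by rewrite le_max lexx.
by rewrite le_max (H x xr) orbT.
Qed.

Lemma integral_sum_indic (k : R) (A : nat -> set R) (N : nat) : 0 <= k ->
  (forall i, measurable (A i)) ->
  (\int[mu]_x (k * \sum_(1 <= i < N) \1_(A i) x)%:E =
   k%:E * \sum_(1 <= i < N) mu (A i))%E.
Proof.
move=> k0 mA; have mI i : measurable_fun [set: R] (fun x => (\1_(A i) x : R)%:E).
  by apply/measurable_EFinP; exact: measurable_indic.
under eq_integral do rewrite EFinM -sumEFin.
rewrite ge0_integralZl_EFin//; first last.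
- exact: emeasurable_sum.
- by move=> x _; apply: sume_ge0 => i _; rewrite lee_fin.
rewrite ge0_integral_sum//; congr (_ * _)%E; apply: eq_bigr => i _.
rewrite integral_indic//; last exact: mA.
by congr (lebesgue_measure _); exact: setIT.
Qed.

Import HBNNSimple.

(** [p] is a simple function below [f] and [F] its supremum, so all levels below [F] are exceeded.
    Rounding [p] down to the grid loses at most [F / N], which the slack between [s] and the
    integral of [p] covers. Every large [N] is allowed so that two functions can share a grid. *)
Lemma layer_cake_lower_sum (f : R -> \bar R) (s : R) : (forall x, 0 <= f x)%E ->
  0 < s -> (s%:E < \int[mu]_x f x)%E ->
  exists (p : R -> R) (F : R) (N0 : nat),
    [/\ measurable_fun [set: R] p, forall x, ((p x)%:E <= f x)%E, 0 < F,
      forall r, r < F -> exists x, r < p x &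
      forall N, (N0 <= N)%N -> (0 < N)%N ->
        (s%:E <= (F / N%:R)%:E * \sum_(1 <= i < N) mu [set x | (i%:R / N%:R * F < p x)%R])%E].
Proof.
move=> f0 s0 /(integral_gt_nnsfun f0)[p pf sp].
have [s1 ss1 s1p] : exists2 s1 : R, s < s1 & (s1%:E <= \int[mu]_x (p x)%:E)%E.
  move: sp; case: (\int[_]_x _)%E => [v| |]//; first by rewrite lte_fin; exists v.
  by move=> _; exists (s + 1); rewrite ?ltrDl// leey.
have s10 : 0 < s1 by rewrite (lt_trans s0).
have fp : finite_set (range p) by exact: fimfunP.
have [m m0 pm] := finite_set_gap fp.
have hs : has_sup (range p).
  by split; [exists (p 0), 0|exact: finite_set_has_ubound].
have pF x : p x <= sup (range p) by apply: sup_upper_bound => //; exists x.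
set F := sup _ in pF.
have [x0 px0] : exists x, 0 < p x.
  apply: contrapT => /forallNP p0; move: sp.
  rewrite (_ : \int[mu]_x (p x)%:E = 0)%E ?lte_fin ?ltNge ?(ltW s0)//.
  apply: integral0_eq => x _; congr EFin; apply/eqP.
  by rewrite eq_le fun_ge0 andbT leNgt; apply/negP.
have F0 : 0 < F by rewrite (lt_le_trans px0).
pose e := 1 - s / s1.
have e0 : 0 < e by rewrite subr_gt0 ltr_pdivrMr// mul1r.
have mp : measurable_fun [set: R] p.
  have mp : measurable_fun [set: measurableTypeR R] p by exact: measurable_funPT.
  exact: mp.
exists p, F, (Num.bound (F / (m * e))); split => //.
- by move=> r rF; have [_ [x _ <-] rx] := sup_gt (proj1 hs) rF; exists x.
move=> N N0N N0; have N0' : 0 < N%:R :> R by rewrite ltr0n.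
have FN : F / N%:R <= m * e.
  rewrite ler_pdivrMr// mulrC -ler_pdivrMr ?mulr_gt0//.
  apply/ltW/(lt_le_trans (archi_boundP _)); first by rewrite divr_ge0 ?mulr_ge0 ?ltW.
  by rewrite ler_nat.
have mA i : measurable [set x | i%:R / N%:R * F < p x].
  rewrite -[X in measurable X]setTI.
  by have := mp measurableT `]i%:R / N%:R * F, +oo[%classic (measurable_itv _);
    congr measurable; apply/seteqP; split => x [] // _; rewrite /= in_itv/= ?andbT.
rewrite -integral_sum_indic ?divr_ge0 ?(ltW F0) ?(ltW N0')//.
(* The shrunken function still has integral at least [s]; the fraction [e] given up is at least
   [m * e], hence at least [F / N], where [p] is positive. *)
apply: (@le_trans _ _ (\int[mu]_x ((s / s1) * p x)%:E)%E).
  under eq_integral do rewrite EFinM.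
  rewrite ge0_integralZl_EFin ?divr_ge0 ?(ltW s0) ?(ltW s10)//; first last.
  - exact/measurable_EFinP.
  - by move=> x _; rewrite lee_fin.
  rewrite -[leLHS](_ : (s / s1)%:E * s1%:E = s%:E)%E; last first.
    by rewrite -EFinM divfK// gt_eqF.
  by rewrite lee_wpmul2l// lee_fin divr_ge0 ?ltW.
apply: le_integralT => x; rewrite lee_fin; first by rewrite mulr_ge0 ?divr_ge0 ?(ltW s0) ?(ltW s10).
have [px|px] := ltP 0 (p x); last first.
  rewrite (@le_trans _ _ 0)//.
    by rewrite mulr_ge0_le0// divr_ge0 ?ltW.
  by rewrite mulr_ge0 ?sumr_ge0// ?divr_ge0 ?ltW.
have yN : p x / F * N%:R <= N%:R.
  by rewrite ler_piMl ?(ltW N0')// ler_pdivrMr// mul1r.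
have FN0 : 0 <= F / N%:R by rewrite divr_ge0 ?ltW.
have H := ler_wpM2l FN0 (count_nat_lt yN).
apply: (le_trans (le_trans _ H)).
  have -> : F / N%:R * (p x / F * N%:R - 1) = p x - F / N%:R.
    by field; rewrite !gt_eqF.
  rewrite lerBrDr -lerBrDl (le_trans FN)//.
  have -> : p x - s / s1 * p x = p x * e by rewrite /e; ring.
  by rewrite ler_pM2r// pm//; exists x.
rewrite ler_pM2l ?divr_gt0//; apply: ler_sum => i _.
rewrite indicE ler_nat; apply/eq_leq; congr nat_of_bool.
rewrite [RHS](_ : _ = (i%:R / N%:R * F < p x)); last by apply/idP/idP; rewrite inE.
by rewrite -ltr_pdivlMr// ltr_pdivrMr.
Qed.

End LayerCake.

(** * The Borell-Brascamp-Lieb inequality, on the line and then in all dimensions *)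

Section BorellBrascampLieb.
Context {R : realType}.
Local Notation mu := (@lebesgue_measure R).

(* Quantifying over reals [s < f x] rather than using [f x] itself covers the
   values [+oo] and [0] without extending [pmean] to them. *)
Lemma bbl_line (b c d k l : R) (f g h : R -> \bar R) : 1 < b ->
  0 < c -> 0 < d -> 0 < k -> 0 < l ->
  (forall x, 0 <= f x)%E -> (forall x, 0 <= g x)%E -> (forall x, 0 <= h x)%E ->
  (forall x y s t, 0 < s -> 0 < t -> (s%:E < f x)%E -> (t%:E < g y)%E ->
    ((pmean b (k * s) (l * t))%:E <= h (c * x + d * y)%R)%E) ->
  forall s t, 0 < s -> 0 < t ->
    (s%:E < \int[mu]_x f x)%E -> (t%:E < \int[mu]_x g x)%E ->
    ((pmean (b - 1) (c * k * s) (d * l * t))%:E <= \int[mu]_x h x)%E.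
Proof.
move=> b1 c0 d0 k0 l0 f0 g0 h0 H s t s0 t0 sf tg.
have b0 : 0 < b by rewrite (lt_trans _ b1).
have [p [F [N1 [mp pf F0 pF HF]]]] := layer_cake_lower_sum f0 s0 sf.
have [q [G [N2 [mq qg G0 qG HG]]]] := layer_cake_lower_sum g0 t0 tg.
pose N := maxn (maxn N1 N2) 1.
have N0 : (0 < N)%N by rewrite leq_max orbT.
have {}HF := HF N _ N0; have {}HG := HG N _ N0.
have {}HF := HF (leq_trans (leq_maxl _ _) (leq_maxl _ _)).
have {}HG := HG (leq_trans (leq_maxr _ _) (leq_maxl _ _)).
have N0' : 0 < N%:R :> R by rewrite ltr0n.
pose A i := [set x | i%:R / N%:R * F < p x].
pose B i := [set x | i%:R / N%:R * G < q x].
have mE (r : R -> R) (v : R) : measurable_fun [set: R] r -> measurable [set x | v < r x].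
  move=> mr; rewrite -[X in measurable X]setTI.
  by have := mr measurableT `]v, +oo[%classic (measurable_itv _);
    congr measurable; apply/seteqP; split => x [] // _; rewrite /= in_itv/= ?andbT.
have /choice[C HC] (i : nat) : exists C : set R, measurable C /\ ((i < N)%N ->
    C `<=` [set c * x + d * y | x in A i & y in B i] /\
    (c%:E * mu (A i) + d%:E * mu (B i) <= mu C)%E).
  have [iN|] := boolP (i < N)%N; last by exists set0; split => //; exact: measurable0.
  have iN1 : i%:R / N%:R < 1 :> R by rewrite ltr_pdivrMr// mul1r ltr_nat.
  have [|x Ax] := pF (i%:R / N%:R * F); first by rewrite gtr_pMl.
  have [|y By] := qG (i%:R / N%:R * G); first by rewrite gtr_pMl.
  have [] := @sumset_measure R c d (A i) (B i) c0 d0 (mE _ _ mp) (mE _ _ mq).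
  - by exists x.
  - by exists y.
  by move=> C [mC CAB CE]; exists C.
pose M := pmean b (k * F) (l * G).
have M0 : 0 < M by rewrite pmean_gt0// mulr_gt0.
have hC i z : (0 < i < N)%N -> C i z -> ((i%:R / N%:R * M)%:E <= h z)%E.
  move=> /andP[i0 iN]; have [_ /(_ iN)[CAB _]] := HC i.
  move=> /CAB[x Ax [y By <-]].
  have iN0 : 0 < i%:R / N%:R :> R by rewrite divr_gt0// ltr0n.
  rewrite /M -(pmeanZ b0 iN0 (mulr_gt0 k0 F0) (mulr_gt0 l0 G0)).
  rewrite (mulrCA _ k) (mulrCA _ l).
  apply: H; [exact: mulr_gt0|exact: mulr_gt0| |].
    by rewrite (lt_le_trans _ (pf x))// lte_fin.
  by rewrite (lt_le_trans _ (qg y))// lte_fin.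
have MN0 : 0 <= M / N%:R by rewrite divr_ge0 ?ltW.
(* The sets [C i] need not be nested: the largest index whose set contains [z] bounds the number of
   nonzero indicators above and, by [hC], [h z] below. *)
have hsum z K : (K <= N)%N -> ((M / N%:R * \sum_(1 <= i < K) \1_(C i) z)%:E <= h z)%E.
  elim: K => [|[|K] IH] KN; first by rewrite big_geq// mulr0.
    by rewrite big_geq// mulr0.
  rewrite big_nat_recr//= indicE; have [/set_mem Cz|_] := boolP (z \in C K.+1); last first.
    by rewrite addr0 IH// ltnW.
  apply: le_trans (hC K.+1 z KN Cz); rewrite lee_fin.
  rewrite [leRHS]mulrAC (mulrC _ M) [leRHS]mulrAC ler_wpM2l//.
  rewrite -natr1 lerD2r (@le_trans _ _ (\sum_(1 <= i < K.+1) 1))//.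
    by apply: ler_sum => i _; rewrite indicE; case: (_ \in _).
  by rewrite sumr_const_nat subn1.
apply: (@le_trans _ _ (\int[mu]_x (M / N%:R * \sum_(1 <= i < N) \1_(C i) x)%:E)%E); last first.
  apply: le_integralT => x; last exact: hsum.
  by rewrite lee_fin mulr_ge0// sumr_ge0.
rewrite integral_sum_indic//; last by move=> i; have [] := HC i.
apply: (@le_trans _ _ ((M / N%:R)%:E *
  \sum_(1 <= i < N) (c%:E * mu (A i) + d%:E * mu (B i)))%E); last first.
  rewrite lee_wpmul2l ?lee_fin// !big_nat; apply: lee_sum => i /andP[_ iN].
  by have [_ /(_ iN)[]] := HC i.
rewrite big_split/= -!ge0_sume_distrr// ge0_muleDr ?mule_ge0 ?sume_ge0 ?lee_fin ?(ltW c0) ?(ltW d0)//.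
apply: (@le_trans _ _ ((M * c / F)%:E * s%:E + (M * d / G)%:E * t%:E)%E).
  rewrite -!EFinM -EFinD lee_fin.
  apply: (le_trans (@pmean_holder R b (k * F) (l * G) _ _ b1 _ _ _ _)); rewrite ?mulr_gt0// -/M.
  rewrite le_eqVlt; apply/orP; left; apply/eqP; move: M {hC hsum M0 MN0} => M.
  by field; rewrite !gt_eqF.
apply: leeD; rewrite [leRHS]muleA -(EFinM (M / N%:R)).
  rewrite (_ : M / N%:R * c = M * c / F * (F / N%:R)); last by field; rewrite !gt_eqF.
  by rewrite (EFinM _ (_ / N%:R)) -muleA lee_wpmul2l// lee_fin divr_ge0 ?mulr_ge0 ?ltW.
rewrite (_ : M / N%:R * d = M * d / G * (G / N%:R)); last by field; rewrite !gt_eqF.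
by rewrite (EFinM _ (_ / N%:R)) -muleA lee_wpmul2l// lee_fin divr_ge0 ?mulr_ge0 ?ltW.
Qed.

Lemma intRn_ge0 n (f : 'rV[R]_n -> \bar R) : (forall x, 0 <= f x)%E -> (0 <= intRn f)%E.
Proof.
elim: n f => [|n IH] f f0 /=; first exact: f0.
by apply: integral_ge0 => x _; apply: IH.
Qed.

Lemma le_intRn n (f g : 'rV[R]_n -> \bar R) : (forall x, 0 <= f x)%E ->
  (forall x, f x <= g x)%E -> (intRn f <= intRn g)%E.
Proof.
elim: n f g => [|n IH] f g f0 fg /=; first exact: fg.
apply: le_integralT => x; first exact: intRn_ge0.
exact: IH.
Qed.

(** The induction hypothesis on slices gives the assumption of [bbl_line] for the partial integrals,
    with exponent [b - n]; the factors [k] and [l] are there to absorb [c ^+ n] and [d ^+ n]. *)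
Lemma borell_brascamp_lieb n (b c d k l : R) (f g h : 'rV[R]_n -> \bar R) : n%:R < b ->
  0 < c -> 0 < d -> 0 < k -> 0 < l ->
  (forall x, 0 <= f x)%E -> (forall x, 0 <= g x)%E -> (forall x, 0 <= h x)%E ->
  (forall x y s t, 0 < s -> 0 < t -> (s%:E < f x)%E -> (t%:E < g y)%E ->
    ((pmean b (k * s) (l * t))%:E <= h (c *: x + d *: y)%R)%E) ->
  forall s t, 0 < s -> 0 < t -> (s%:E < intRn f)%E -> (t%:E < intRn g)%E ->
    ((pmean (b - n%:R) (c ^+ n * k * s) (d ^+ n * l * t))%:E <= intRn h)%E.
Proof.
elim: n f g h => [|n IH] f g h nb c0 d0 k0 l0 f0 g0 h0 H s t s0 t0 /=.
  move=> sf tg; rewrite subr0 !expr0 !mul1r.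
  by have := H _ _ _ _ s0 t0 sf tg; rewrite !scaler0 addr0.
have nb' : 1 < b - n%:R by rewrite ltrBrDr addrC natr1.
have -> : b - n.+1%:R = b - n%:R - 1 by rewrite -natr1 opprD addrA.
rewrite !exprS -!(mulrA _ (_ ^+ n)).
apply: bbl_line => //; rewrite ?mulr_gt0 ?exprn_gt0//; try by move=> ?; exact: intRn_ge0.
move=> {s0 t0}x y {}s {}t s0 t0; apply: IH => //.
  by rewrite (lt_trans _ nb)// ltr_nat.
move=> v w s' t' s'0 t'0 sf tg.
have <- : c *: row_mx (const_mx x : 'rV_1) v + d *: row_mx (const_mx y : 'rV_1) w =
    row_mx (const_mx (c * x + d * y)) (c *: v + d *: w).
  by rewrite !scale_row_mx add_row_mx; congr row_mx; apply/matrixP => i j; rewrite !mxE.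
exact: H.
Qed.

End BorellBrascampLieb.

(** * Integrability of [G_alpha] *)

Section Gaussian.
Context {R : realType}.
Local Notation mu := (@lebesgue_measure R).

Lemma ler_powR_npos (c x y : R) : c <= 0 -> 0 < x -> x <= y -> y `^ c <= x `^ c.
Proof.
move=> c0 x0 xy; have y0 : 0 < y by rewrite (lt_le_trans x0).
rewrite -(opprK c) !(powRN _ (- c)) lef_pV2 ?posrE ?powR_gt0//.
by rewrite ge0_ler_powR ?oppr_ge0// nnegrE ltW.
Qed.

Lemma sqnorm_ge0 n (x : 'rV[R]_n) : 0 <= sqnorm x.
Proof. by apply: sumr_ge0 => i _; exact: sqr_ge0. Qed.

Lemma sqnormZ n c (x : 'rV[R]_n) : sqnorm (c *: x) = c ^+ 2 * sqnorm x.
Proof. by rewrite /sqnorm mulr_sumr; apply: eq_bigr => i _; rewrite mxE exprMn. Qed.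

Lemma integral_cauchy (m : R) : 0 <= m ->
  exists C : R, (\int[mu]_x (m * (oneDsqr x)^-1)%:E = C%:E)%E.
Proof.
move=> m0; exists (m * (2 * (pi / 2))).
under eq_integral do rewrite EFinM.
have cont : continuous (fun x : R => (oneDsqr x)^-1) by exact: continuous_oneDsqrV.
have ge0 x : 0 <= (oneDsqr x)^-1 :> R by rewrite invr_ge0 (le_trans ler01) ?oneDsqr_ge1.
have mcont : measurable_fun [set: R] (fun x : R => (oneDsqr x)^-1%:E).
  by apply/measurable_EFinP; exact: continuous_measurable_fun.
rewrite ge0_integralZl_EFin// ge0_symfun_integralT//; last first.
  by move=> x /=; rewrite /oneDsqr sqrrN.
rewrite [X in integral _ X _](_ : _ = `[0%R, +oo[%classic); last first.
  by apply/seteqP; split => x /=; rewrite in_itv/= andbT.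
by rewrite integral0y_oneDsqr -!EFinM.
Qed.

(** The constant [k] serves the induction: in a slice, the factor of the first coordinate joins
    it. *)
Lemma intRn_prod n (k C : R) (p : R -> R) : 0 <= k -> (forall x, 0 <= p x) ->
  measurable_fun [set: R] p -> (\int[mu]_x (p x)%:E = C%:E)%E ->
  intRn (fun x : 'rV[R]_n => (k * \prod_i p (x ord0 i))%:E) = (k * C ^+ n)%:E.
Proof.
move=> k0 p0 mp pC; elim: n k k0 => [|n IH] k k0 /=; first by rewrite big_ord0.
have C0 : 0 <= C by rewrite -lee_fin -pC integral_ge0// => x _; rewrite lee_fin.
transitivity (\int[mu]_t ((k * C ^+ n)%:E * (p t)%:E))%E.
  apply: eq_integral => t _; rewrite -EFinM mulrAC -IH ?mulr_ge0//.
  congr intRn; apply/funext => v; rewrite big_ord_recl mulrA; congr (_ * _)%:E.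
    have -> : (ord0 : 'I_n.+1) = lshift n (ord0 : 'I_1) by exact: val_inj.
    congr (k * p _); apply: (etrans (@row_mxEl R 1 1 n (const_mx t) v ord0 ord0)).
    by rewrite mxE.
  apply: eq_bigr => i _.
  have -> : lift (ord0 : 'I_n.+1) i = rshift 1 i by exact: val_inj.
  by congr (p _); exact: (@row_mxEr R 1 1 n (const_mx t) v ord0 i).
rewrite ge0_integralZl_EFin ?pC ?mulr_ge0 ?exprn_ge0//.
- by rewrite -EFinM exprSr mulrA.
- by move=> x _; rewrite lee_fin.
- exact/measurable_EFinP.
Qed.

Lemma G_alpha_gt0 n (a : R) (x : 'rV[R]_n) : a < 0 -> 0 < G_alpha a x.
Proof.
move=> a0; rewrite powR_gt0// ltr_pwDl// mulr_ge0 ?sqnorm_ge0// invr_ge0 mulr_ge0//.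
by rewrite /beta_of oppr_ge0 invr_le0 ltW.
Qed.

(** The base [y] is at least 1, so its power [beta] dominates [y ^+ n], and each of these [n]
    factors dominates [(1 + x_i^2) / (2 beta)]. *)
Lemma G_alpha_le_prod n (a : R) (x : 'rV[R]_n) : (0 < n)%N -> n%:R < beta_of a ->
  G_alpha a x <= 1 * \prod_i (2 * beta_of a * (oneDsqr (x ord0 i))^-1).
Proof.
rewrite /G_alpha; move: (beta_of a) => b n0 nb; rewrite mul1r.
have n1 : 1 <= n%:R :> R by rewrite ler1n.
have b2 : 0 < 2 * b by lra.
set y := 1 + _; have y1 : 1 <= y by rewrite lerDl divr_ge0 ?sqnorm_ge0 ?ltW.
have y0 : 0 < y by rewrite (lt_le_trans _ y1).
have u0 i : 0 < oneDsqr (x ord0 i) by rewrite (lt_le_trans ltr01)// oneDsqr_ge1.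
under eq_bigr do rewrite -[2 * b]invrK -invfM.
rewrite prodfV powRN lef_pV2 ?posrE ?powR_gt0 ?prodr_gt0//; last first.
  by move=> i _; rewrite mulr_gt0// invr_gt0.
apply: (@le_trans _ _ (y ^+ n)); last first.
  by rewrite -powR_mulrn ?(ltW y0)// ler_powR// ltW.
rewrite -[n in leRHS]card_ord -prodr_const ler_prod// => i _.
rewrite mulr_ge0 ?invr_ge0 ?(ltW b2) ?(ltW (u0 i))//= mulrC ler_pdivrMr// /y mulrDl mul1r divfK ?gt_eqF//.
rewrite /oneDsqr lerD//; first by lra.
by rewrite /sqnorm (bigD1 i)//= lerDl sumr_ge0// => j _; exact: sqr_ge0.
Qed.

Lemma intRn_G_alpha_fin_num n (a : R) : (0 < n)%N -> a < 0 -> n%:R < beta_of a ->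
  intRn (fun x : 'rV[R]_n => (G_alpha a x)%:E) \is a fin_num.
Proof.
move=> n0 a0 nb; have b0 : 0 <= 2 * beta_of a.
  by rewrite mulr_ge0// (le_trans _ (ltW nb)).
have [C HC] := integral_cauchy b0.
rewrite ge0_fin_numE; last by apply: intRn_ge0 => x; rewrite lee_fin ltW// G_alpha_gt0.
apply: (@le_lt_trans _ _ (1 * C ^+ n)%:E); last exact: ltry.
rewrite -(intRn_prod n _ _ _ HC)//; first last.
- apply: continuous_measurable_fun => x; apply: cvgM; first exact: cvg_cst.
  exact: continuous_oneDsqrV.
- by move=> x; rewrite mulr_ge0// invr_ge0 (le_trans ler01) ?oneDsqr_ge1.
apply: le_intRn => x; rewrite lee_fin; first by rewrite ltW// G_alpha_gt0.
exact: G_alpha_le_prod.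
Qed.

End Gaussian.

(** * A pointwise lower bound for the a-sum *)

Section AlphaSum.
Context {R : realType}.

Lemma unbase_ge0 (a : R) phi : (0 <= unbase a phi)%E.
Proof. by case: phi => [r| |] //=; case: ifP => // _; rewrite lee_fin powR_ge0. Qed.

(** Through this, an upper bound on the infimal convolution becomes a lower bound on the a-sum. *)
Lemma le_unbase (a : R) phi psi : a < 0 -> (phi <= psi)%E ->
  (unbase a psi <= unbase a phi)%E.
Proof.
move=> a0; have b0 : 0 < beta_of a by rewrite oppr_gt0 invr_lt0.
case: phi => [r| |]; case: psi => [r'| |] //=; rewrite ?leey// ?lee_fin; last first.
  by move=> _; exact: (@unbase_ge0 a r%:E).
move=> rr'; have [r0|_] := boolP (0 < 1 + r / beta_of a); last exact: leey.
have rr : 1 + r / beta_of a <= 1 + r' / beta_of a by rewrite lerD2l ler_pM2r ?invr_gt0.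
rewrite (lt_le_trans r0 rr) lee_fin ler_powR_npos//.
by rewrite oppr_le0 ltW.
Qed.

Lemma G_sum_eps_ge n (a e : R) (f : 'rV[R]_n -> R) (x y : 'rV[R]_n) (s t : R) :
  a < 0 -> 0 < e -> e < 1 -> 0 < s -> 0 < t -> s < G_alpha a x -> t < f y ->
  ((pmean (beta_of a) ((1 - e) `^ (- beta_of a) * s) (e `^ (- beta_of a) * t))%:E
   <= G_sum_eps a e f (Num.sqrt (1 - e) *: x + e *: y)%R)%E.
Proof.
move=> a0 e0 e1 s0 t0 sG tf; rewrite /G_sum_eps /alpha_sum_base.
have an0 : a != 0 by rewrite lt_eqF.
have b0 : 0 < beta_of a by rewrite oppr_gt0 invr_lt0.
have bV : - (beta_of a)^-1 = a by rewrite /beta_of invrN opprK invrK.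
have aV : a^-1 = - beta_of a by rewrite /beta_of opprK.
have e1' : 0 < 1 - e by rewrite subr_gt0.
have GE z : (@G_alpha R n a z) `^ a = 1 + sqnorm z / (2 * beta_of a).
  rewrite /G_alpha -powRrM -aV mulVf// powRr1// addr_ge0// mulr_ge0 ?sqnorm_ge0//.
  by rewrite invr_ge0 mulr_ge0// ltW.
have base_sum_le : (infconv (base_alpha a (@G_alpha R n a)) (alpha_scale_base a e f)
    (Num.sqrt (1 - e) *: x + e *: y) <=
    ((1 - e) * sqnorm x / 2 + e * (beta_of a * (f y `^ a - 1)))%:E)%E.
  (* The base of [G_alpha] is [|x|^2 / 2], so scaling by the square root multiplies it by exactly
     [1 - e]. *)
  apply: ereal_inf_lbound; exists (Num.sqrt (1 - e) *: x) => //.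
  rewrite /base_alpha G_alpha_gt0// /alpha_scale_base addrAC subrr add0r scalerA mulVf ?gt_eqF//.
  rewrite scale1r /base_alpha (lt_trans t0 tf) -EFinM -EFinD; congr EFin.
  rewrite GE sqnormZ sqr_sqrtr ?ltW// aV.
  move: (f y `^ a) (sqnorm x) b0 => ? ?; move: (beta_of a) => ? ?.
  by field; rewrite gt_eqF.
apply: le_trans (le_unbase a0 base_sum_le) => {base_sum_le} /=.
have -> : 1 + ((1 - e) * sqnorm x / 2 + e * (beta_of a * (f y `^ a - 1))) / beta_of a =
    (1 - e) * G_alpha a x `^ a + e * f y `^ a.
  rewrite GE; move: (f y `^ a) (sqnorm x) b0 => ? ?; move: (beta_of a) => ? ?.
  by field; rewrite gt_eqF.
move: (G_alpha a x) (f y) (beta_of a) sG tf b0 bV aV {GE} => u v b su tv b0 bV aV.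
have ap0 : 0 < (1 - e) * u `^ a + e * v `^ a.
  by rewrite addr_gt0// mulr_gt0// powR_gt0//; [exact: lt_trans su|exact: lt_trans tv].
rewrite ap0 lee_fin /pmean bV.
rewrite (powRM _ (powR_ge0 _ _) (ltW s0)) (powRM _ (powR_ge0 _ _) (ltW t0)).
rewrite -!powRrM (_ : - b * a = 1); last by rewrite -aV mulVf.
rewrite (powRr1 (ltW e1')) (powRr1 (ltW e0)).
apply: ler_powR_npos => //; first by rewrite oppr_le0 ltW.
by rewrite lerD// ler_pM2l// ler_powR_npos// ltW.
Qed.

End AlphaSum.

(** * First-order estimates as [e] tends to 0 *)

Section Derivative.
Context {R : realType}.

(** With [u = c e], the power is at most [exp (-u)], and [exp u >= 1 + u] while
    [(1 + u) (1 - u + u^2) = 1 + u^3 >= 1]. *)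
Lemma onem_powR_le (c e : R) : 0 <= c -> 0 < e -> e < 1 ->
  (1 - e) `^ c <= 1 - c * e + (c * e) ^+ 2.
Proof.
move=> c0 e0 e1; have e1' : 0 < 1 - e by rewrite subr_gt0.
have u0 : 0 <= c * e by rewrite mulr_ge0// ltW.
rewrite /powR gt_eqF//; apply: (@le_trans _ _ (expR (- (c * e)))).
  by rewrite ler_expR -mulrN ler_wpM2l// le_ln1Dx// ltrN2.
rewrite expRN invf_ple ?posrE ?expR_gt0//; last by nra.
apply: le_trans (expR_ge1Dx _); move: (c * e) u0 => u u0.
have d0 : 0 < 1 - u + u ^+ 2 by nra.
rewrite -div1r ler_pdivrMr//; have : 0 <= u ^+ 3 by rewrite exprn_ge0.
by rewrite (_ : (1 + u) * (1 - u + u ^+ 2) = 1 + u ^+ 3) ?lerDl//; ring.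
Qed.

Lemma limf_einf_at_right_ge (F : R -> \bar R) (L K : R) : 0 <= K ->
  (forall e, 0 < e -> e < 1 -> ((L - K * e)%:E <= F e)%E) ->
  (L%:E <= limf_einf F (0 : R)^'+)%E.
Proof.
move=> K0 H; apply/lee_subgt0Pr => d d0; rewrite limf_einfE.
have K1 : 0 < K + 1 by rewrite ltr_wpDl.
(* [K + 1] replaces [K] because [K] may be 0. *)
pose r := Num.min 1 (d / (K + 1)).
have r0 : 0 < r by rewrite lt_min ltr01 divr_gt0.
apply: le_ereal_sup_tmp; exists (ereal_inf (F @` `]0, r[)).
  exists `]0, r[%classic => //; near=> e; rewrite /= in_itv/=; apply/andP; split => //.
apply: le_ereal_inf_tmp => _ [e /= + <-]; rewrite in_itv/= lt_min => /and3P[e0 e1 er].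
apply: le_trans (H _ e0 e1); rewrite -EFinB lee_fin lerD2l lerN2.
rewrite ltr_pdivlMr// mulrC in er; apply: le_trans (ltW er).
by rewrite ler_wpM2r ?ltW// ltrDl.
Unshelve. all: by end_near. Qed.

End Derivative.

(** * The lower bound for [w_alpha_liminf] *)

Section MixedIntegral.
Context {R : realType}.
Variables (n : nat) (a : R) (f : 'rV[R]_n -> R).
Hypotheses (n_gt0 : (0 < n)%N) (na : - n%:R^-1 < a) (a0 : a < 0).
Hypothesis f_ge0 : forall x, 0 <= f x.

Local Notation k := (a / (1 + n%:R * a)).
Local Notation IG := (intRn (fun x : 'rV[R]_n => (G_alpha a x)%:E)).
Local Notation If := (intRn (fun x : 'rV[R]_n => (f x)%:E)).

Let nR : 0 < n%:R :> R. Proof. by rewrite ltr0n. Qed.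

Let d0 : 0 < 1 + n%:R * a.
Proof. by move: na; rewrite ltrNl -(ltr_pM2l nR) mulfV ?gt_eqF// => H; lra. Qed.

(** Hence the exponent [beta - n] left by Borell-Brascamp-Lieb in dimension [n] is [-1/k]. *)
Let kinv : k^-1 = n%:R - beta_of a.
Proof. by rewrite /beta_of opprK; field; rewrite lt_eqF//= gt_eqF. Qed.

Let k_lt0 : k < 0. Proof. by rewrite pmulr_llt0// invr_gt0. Qed.

Let nb : n%:R < beta_of a. Proof. by rewrite -subr_lt0 -kinv invr_lt0. Qed.

Let IG_fin : IG \is a fin_num. Proof. exact: intRn_G_alpha_fin_num. Qed.

Let G_sum_eps_ge0 e x : (0 <= G_sum_eps a e f x)%E.
Proof. exact: unbase_ge0. Qed.

(** Settles the degenerate value 0 of [IG], for which the claimed bound is 0, in place of a proof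
    that [IG] is positive. *)
Lemma w_quot_ge0 e : 0 < e -> IG = 0%E -> (0 <= w_quot a f e)%E.
Proof.
move=> e0 G0; by rewrite /w_quot G0 sube0 mule_ge0 ?intRn_ge0// lee_fin invr_ge0 ltW.
Qed.

Lemma intRn_G_sum_eps_ge e (g T : R) : 0 < e -> e < 1 -> IG = g%:E -> 0 < g -> 0 < T ->
  (T%:E <= If)%E ->
  ((pmean (beta_of a - n%:R) ((1 - e) `^ (n%:R / 2 - beta_of a) * g)
     (e `^ (n%:R - beta_of a) * T))%:E <= intRn (G_sum_eps a e f))%E.
Proof.
move=> e0 e1 IGg g0 T0 TI; have e1' : 0 < 1 - e by rewrite subr_gt0.
have b0 : 0 < beta_of a - n%:R by rewrite subr_gt0.
have cE : Num.sqrt (1 - e) ^+ n * (1 - e) `^ (- beta_of a) = (1 - e) `^ (n%:R / 2 - beta_of a).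
  rewrite -(powR12_sqrt (ltW e1')) -powR_mulrn ?powR_ge0// -powRrM -powRD; last first.
    by rewrite (gt_eqF e1') implybT.
  by rewrite mulrC.
have eE : e ^+ n * e `^ (- beta_of a) = e `^ (n%:R - beta_of a).
  by rewrite -powR_mulrn ?(ltW e0)// -powRD// (gt_eqF e0) implybT.
have A0 : 0 < (1 - e) `^ (n%:R / 2 - beta_of a) by rewrite powR_gt0.
have B0 : 0 < e `^ (n%:R - beta_of a) by rewrite powR_gt0.
(* Borell-Brascamp-Lieb asks for values strictly below the integrals: [r g] and [r T] with [r < 1]
   qualify, and homogeneity of [pmean] extracts [r]. *)
apply/lee_mul01Pr; first by rewrite lee_fin ltW// pmean_gt0// mulr_gt0.
move=> r /andP[r0 r1]; rewrite -EFinM -(pmeanZ b0 r0 (mulr_gt0 A0 g0) (mulr_gt0 B0 T0)).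
rewrite (mulrCA r) (mulrCA r _ T) -cE -eE.
apply: (@borell_brascamp_lieb _ n (beta_of a) _ _ _ _ (fun x => (G_alpha a x)%:E)
  (fun x => (f x)%:E)) => //; rewrite ?sqrtr_gt0 ?powR_gt0 ?mulr_gt0//.
- by move=> x; rewrite lee_fin ltW// G_alpha_gt0.
- by move=> x y s t s0 t0 sG tf; apply: G_sum_eps_ge; rewrite ?lte_fin in sG tf *.
- by rewrite IGg lte_fin gtr_pMl.
- by apply: lt_le_trans TI; rewrite lte_fin gtr_pMl.
Qed.

(** The outer power [1/k] is negative: its tangent at 1 lies below it and has negative slope, so the
    upper bound [onem_powR_le] yields a lower one. The quadratic remainder becomes an error linear
    in [e] after division. *)
Lemma w_quot_ge e (g T : R) : 0 < e -> e < 1 -> IG = g%:E -> 0 < g -> 0 < T ->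
  (T%:E <= If)%E ->
  ((g * (n%:R / 2 + k^-1 * (T / g) `^ k - k^-1) -
    g * (1 - n%:R / 2 * k) ^+ 2 * - k^-1 * e)%:E <= w_quot a f e)%E.
Proof.
move=> e0 e1 IGg g0 T0 TI; have := intRn_G_sum_eps_ge e0 e1 IGg g0 T0 TI.
have e1' : 0 < 1 - e by rewrite subr_gt0.
have kV0 : k^-1 < 0 by rewrite invr_lt0.
have k0 : k != 0 by rewrite lt_eqF.
have bE : beta_of a = n%:R - k^-1 by rewrite kinv opprB addrC subrK.
rewrite /w_quot IGg bE; move: (k) kV0 k0 k_lt0 {bE} => q qV0 q0 qlt0.
have -> : n%:R - q^-1 - n%:R = - q^-1 by rewrite addrAC subrr add0r.
have -> : n%:R - (n%:R - q^-1) = q^-1 by rewrite opprB addrC subrK.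
set A := _ `^ (n%:R / 2 - _); set B := e `^ _.
have A0 : 0 < A by rewrite powR_gt0.
have B0 : 0 < B by rewrite powR_gt0.
have Tg0 : 0 < T / g by rewrite divr_gt0.
have -> : A * g = g * A by rewrite mulrC.
have -> : B * T = g * (B * (T / g)) by field; rewrite gt_eqF.
have qN0 : 0 < - q^-1 by rewrite oppr_gt0.
rewrite (pmeanZ qN0 g0 A0 (mulr_gt0 B0 Tg0)) /pmean !invrN !opprK invrK (powRM _ (ltW B0) (ltW Tg0)).
have AE : A `^ q = (1 - e) `^ (1 - n%:R / 2 * q).
  by rewrite /A -powRrM; congr (_ `^ _); field.
have BE : B `^ q = e by rewrite /B -powRrM mulVf// powRr1// ltW.
rewrite AE BE => H; rewrite lee_pdivlMr// leeBrDr//.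
apply: le_trans H; rewrite -EFinM -EFinD lee_fin.
have r0 : 0 <= (T / g) `^ q by exact: powR_ge0.
move: ((T / g) `^ q) r0 => r r0.
have c0 : 0 <= 1 - n%:R / 2 * q by rewrite subr_ge0 (le_trans _ ler01)// mulr_ge0_le0 ?ltW// divr_gt0.
have cle := onem_powR_le c0 e0 e1.
have S0 : 0 < (1 - e) `^ (1 - n%:R / 2 * q) + e * r.
  by rewrite ltr_wpDr ?powR_gt0// mulr_ge0// ltW.
have := powR_negr_tangent qV0 S0.
move: (_ `^ (1 - n%:R / 2 * q)) cle {S0 A0 AE} => w cle H.
apply: (@le_trans _ _ (g * (1 + q^-1 * (w + e * r - 1)))); last by rewrite ler_pM2l.
have : q^-1 * (1 - (1 - n%:R / 2 * q) * e + ((1 - n%:R / 2 * q) * e) ^+ 2) <= q^-1 * w.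
  by rewrite ler_nM2l.
rewrite -(ler_pM2l g0); set u := _ * w; set v := _ * (1 - _ + _) => uv.
have -> : (g * (n%:R / 2 + q^-1 * r - q^-1) - g * (1 - n%:R / 2 * q) ^+ 2 * - q^-1 * e) * e + g
  = g * v + g * (1 + q^-1 * (e * r - 1)) by rewrite /v; field.
have -> : g * (1 + q^-1 * (w + e * r - 1)) = g * u + g * (1 + q^-1 * (e * r - 1)).
  by rewrite /u; ring.
by rewrite lerD2r.
Qed.

Lemma w_alpha_liminf_ge (g T : R) : IG = g%:E -> 0 < g -> 0 < T -> (T%:E <= If)%E ->
  ((g * (n%:R / 2 + k^-1 * (T / g) `^ k - k^-1))%:E <= w_alpha_liminf a f)%E.
Proof.
move=> IGg g0 T0 TI.
apply: (@limf_einf_at_right_ge _ _ _ (g * (1 - n%:R / 2 * k) ^+ 2 * - k^-1)).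
  have kV0 : 0 <= - k^-1 by rewrite oppr_ge0 invr_le0 ltW.
  exact: mulr_ge0 (mulr_ge0 (ltW g0) (sqr_ge0 _)) kV0.
by move=> e e0 e1; exact: w_quot_ge.
Qed.

Lemma w_alpha_liminf_ge_ratio_pow :
  ((fine IG)%:E * ((n%:R / 2)%:E + (k^-1)%:E * ratio_pow If (fine IG) k - (k^-1)%:E)
    <= w_alpha_liminf a f)%E.
Proof.
have IGg : IG = (fine IG)%:E by rewrite fineK.
have : 0 <= fine IG.
  by apply: fine_ge0; apply: intRn_ge0 => x; rewrite lee_fin ltW// G_alpha_gt0.
move: (fine IG) IGg => g IGg; rewrite le_eqVlt => /predU1P[g0|g0].
  rewrite -g0 mul0e; apply: (@limf_einf_at_right_ge _ _ _ 0) => // e e0 _.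
  by rewrite mul0r subr0 w_quot_ge0// IGg -g0.
have kV0 : k^-1 < 0 by rewrite invr_lt0.
have : (0 <= If)%E by apply: intRn_ge0 => x; rewrite lee_fin.
case E : If => [r| |] // r0 /=.
(* For a zero integral [ratio_pow] is [+oo], and [1/k < 0] makes the left side [-oo]. *)
- have [_|rn0] := eqVneq r 0.
    by rewrite lt0_muley ?lte_fin// addNye gt0_muleNy ?lte_fin// leNye.
  rewrite -!EFinM; apply: w_alpha_liminf_ge => //; last by rewrite E.
  by rewrite lt_neqAle eq_sym rn0 -lee_fin.
(* For an infinite integral the ratio term is 0; a finite [T] reaches the bound up to an arbitrary
   [d]. *)
rewrite mule0 adde0 -EFinD -EFinM; apply/lee_subgt0Pr => d d0'.
(* [T] is chosen so that [(T / g) `^ k = r], i.e. the error term equals [d]. *)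
pose r := d / (g * - k^-1).
have gk : 0 < g * - k^-1 by rewrite mulr_gt0// oppr_gt0.
have r1 : 0 < r by rewrite divr_gt0.
have T0 : 0 < g * r `^ k^-1 by rewrite mulr_gt0// powR_gt0.
have TI : ((g * r `^ k^-1)%:E <= If)%E by rewrite E leey.
apply: le_trans (w_alpha_liminf_ge IGg g0 T0 TI).
rewrite -EFinB lee_fin mulrAC mulfV ?gt_eqF// mul1r -powRrM mulVf ?lt_eqF// powRr1 ?(ltW r1)//.
rewrite le_eqVlt; apply/orP; left; apply/eqP; rewrite /r.
by move: (k^-1) kV0 => q qV0; field; rewrite (gt_eqF g0) (lt_eqF qV0).
Qed.

End MixedIntegral.

Unset Implicit Arguments.

Theorem theorem3p7 (R : realType) (n : nat) (a : R) (f : 'rV[R]_n -> R) :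
  (0 < n)%N -> - n%:R^-1 < a -> a < 0 ->
  C_alpha a f ->
  let k := a / (1 + n%:R * a) in
  let g := fine (intRn (fun x : 'rV[R]_n => (G_alpha a x)%:E)) in
  (g%:E * ((n%:R / 2)%:E + (k^-1)%:E * ratio_pow (intRn (fun x => (f x)%:E)) g k
           - (k^-1)%:E) <= w_alpha_liminf a f)%E.
Proof.
move=> n0 na a0 [[f0 _] _] /=.
exact: w_alpha_liminf_ge_ratio_pow.
Qed.
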